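(* For every integer $n \geq 3$ and every prime power $q$, there exists a code $\mathbb{C} \subseteq \mathcal{G}_q\big(\binom{n}{2}, n-1\big)$ with $|\mathbb{C}| = \frac{q^n-1}{q-1}$ such that $\dim(X \cap Y) = 1$ for every two distinct $X, Y \in \mathbb{C}$ (i.e. $\mathbb{C}$ is a $1$-intersecting equidistant code).
   Context: $\mathbb{F}_q$ is the finite field with $q$ elements. $\mathcal{G}_q(N,k)$ denotes the set of all $k$-dimensional subspaces of $\mathbb{F}_q^N$. A code $\mathbb{C}\subseteq \mathcal{G}_q(N,k)$ is called $t$-intersecting if any two distinct codewords intersect in a subspace of dimension exactly $t$; such a code is equidistant with respect to the subspace distance $d_S(X,Y)=\dim X+\dim Y-2\dim(X\cap Y)$. Note $\frac{q^n-1}{q-1}$ is the number of $1$-dimensional subspaces of $\mathbb{F}_q^n$. *)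

(* Defs.v *)
From HB Require Import structures.
From mathcomp Require Import all_boot all_order all_algebra.
From mathcomp Require Import finmap.

Set Implicit Arguments.
Unset Strict Implicit.
Unset Printing Implicit Defensive.

Definition prime_power (q : nat) : Prop :=
  exists p e : nat, [/\ prime p, 0 < e & q = p ^ e].

Definition grassmannian (F : finFieldType) (N k : nat) :
    {pred {vspace 'rV[F]_N}} :=
  [pred U : {vspace 'rV[F]_N} | \dim U == k].
Arguments grassmannian : clear implicits.

(* Codes are {fset _} because {vspace _} is a choiceType but has no canonical
   finType instance, even over a finite field. *)
Definition code (F : finFieldType) (N : nat) : Type :=
  {fset {vspace 'rV[F]_N}}.

Definition t_intersecting (F : finFieldType) (N t : nat) (C : code F N) : Prop :=
  forall X Y : {vspace 'rV[F]_N},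
    X \in C -> Y \in C -> X <> Y -> \dim (X :&: Y)%VS = t.

(* The truncated subtraction is exact, since dim (X :&: Y) is at most both
   dim X and dim Y. *)
Definition subspace_dist (F : finFieldType) (N : nat)
    (X Y : {vspace 'rV[F]_N}) : nat :=
  \dim X + \dim Y - 2 * \dim (X :&: Y)%VS.

Definition equidistant (F : finFieldType) (N : nat) (C : code F N) : Prop :=
  exists d : nat, forall X Y : {vspace 'rV[F]_N},
    X \in C -> Y \in C -> X <> Y -> subspace_dist X Y = d.

(* Main.v *)
(** Let [V = F^n].  The codewords are the subspaces [x ∧ V] of [Λ² V], for [x]
    ranging over the points of the projective space of [V].  The kernel of
    [x ∧ _] is the line of [x], so [x ∧ V] has dimension [n - 1].  If [x] and [y]
    are independent and [x ∧ a = y ∧ b], then [x ∧ y ∧ b = 0], so [b] is a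
    combination of [x] and [y], and [y ∧ b] lies on the line of [x ∧ y]; hence
    [x ∧ V] and [y ∧ V] meet in this line.  As [n - 1 > 1], distinct points
    therefore give distinct codewords. *)

Require Import Defs.
From HB Require Import structures.
From mathcomp Require Import all_boot all_order all_algebra.
From mathcomp Require Import finmap.
From mathcomp Require Import ring.

Set Implicit Arguments.
Unset Strict Implicit.
Unset Printing Implicit Defensive.

Import GRing.Theory.

Definition lower_pairs (n : nat) : {set 'I_n * 'I_n} := 
  [set p : 'I_n * 'I_n | p.2 < p.1].

(** Counting by the first component, exactly [i] indices lie below [i], and [bin2_sum] adds these
    up. *)
Lemma card_lower_pairs (n : nat) : #|lower_pairs n| = 'C(n, 2).
Proof.
rewrite -bin2_sum big_mkord -sum1dep_card.
rewrite -(pair_big_dep predT (fun i j : 'I_n => j < i) (fun _ _ => 1)) /=.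
apply: eq_bigr => i _; rewrite sum1_card -[RHS]card_ord.
have widen_inj : injective (widen_ord (ltnW (ltn_ord i))).
  by move=> j k /(congr1 val) /= /ord_inj.
rewrite -(card_imset _ widen_inj).
apply: eq_card => j; rewrite unfold_in; apply/idP/imsetP => [lt_ji | [k _ ->]].
  by exists (Ordinal lt_ji) => //; apply: val_inj.
by change (k < i); exact: ltn_ord.
Qed.

Local Open Scope ring_scope.

Section Wedge.

Variables (F : fieldType) (n : nat).
Implicit Types x y a b : 'rV[F]_n.

(* The Plücker coordinates of [x ∧ y]. *)
Definition wedge x y : 'rV[F]_#|lower_pairs n| :=
  \row_k (x 0 (enum_val k).1 * y 0 (enum_val k).2
          - x 0 (enum_val k).2 * y 0 (enum_val k).1).

Lemma wedge_is_linear x : linear (wedge x).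
Proof. by move=> c a b; apply/rowP=> k; rewrite !mxE; ring. Qed.

HB.instance Definition _ x :=
  GRing.isLinear.Build F 'rV[F]_n 'rV[F]_#|lower_pairs n| *:%R (wedge x)
    (wedge_is_linear x).

Lemma wedgexx x : wedge x x = 0.
Proof. by apply/rowP=> k; rewrite !mxE; ring. Qed.

Lemma wedgeC x y : wedge y x = - wedge x y.
Proof. by apply/rowP=> k; rewrite !mxE; ring. Qed.

Lemma wedgeZl c x y : wedge (c *: x) y = c *: wedge x y.
Proof. by apply/rowP=> k; rewrite !mxE; ring. Qed.

(** Both sides of the coordinate identity are antisymmetric in [i] and [j], so the pairs with
    [j < i] determine all others. This frees later arguments from the enumeration of
    [lower_pairs]. *)
Lemma eq_wedgeP x a y b :
  wedge x a = wedge y b <->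
  forall i j, x 0 i * a 0 j - x 0 j * a 0 i = y 0 i * b 0 j - y 0 j * b 0 i.
Proof.
split=> [/rowP eq_w i j | eq_w]; last by apply/rowP=> k; rewrite !mxE.
have lower (u v : 'I_n) : (v < u)%N ->
    x 0 u * a 0 v - x 0 v * a 0 u = y 0 u * b 0 v - y 0 v * b 0 u.
  move=> lt_vu; have uvP : (u, v) \in lower_pairs n by rewrite inE.
  by have := eq_w (enum_rank_in uvP (u, v)); rewrite !mxE enum_rankK_in.
have [/lower lt_ij | /lower // | /val_inj ->] := ltngtP i j; last by ring.
by rewrite -[LHS]opprB lt_ij opprB.
Qed.

Lemma wedge_eq0 x y : x != 0 -> (wedge x y == 0) = (y \in <[x]>%VS).
Proof.
move=> /rV0Pn[i xi0]; apply/eqP/vlineP => [w0 | [c ->]]; last first.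
  by rewrite linearZ /= wedgexx scaler0.
(* All 2 x 2 minors of [x] and [y] vanish; those through the pivot [x 0 i] give the ratio of [y] to
   [x]. *)
have /eq_wedgeP xy : wedge x y = wedge x 0 by rewrite w0 linear0.
exists (y 0 i / x 0 i); apply/rowP=> j; rewrite !mxE.
apply: (mulfI xi0); rewrite mulrA mulrCA divff // mulr1.
by have := xy i j; rewrite !mxE !mulr0 subrr => /subr0_eq ->; rewrite mulrC.
Qed.

Lemma wedge_eq_line x y a b :
  wedge x y != 0 -> wedge x a = wedge y b -> wedge y b \in <[wedge x y]>%VS.
Proof.
move=> /rV0Pn[k]; rewrite mxE; set i := _.1; set j := _.2.
set d := _ - _ => d0 /eq_wedgeP xayb.
(* The minor of the rows [x], [y], [b] in columns [i], [j], [l] is zero; its expansion along column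
   [l] is solved for [b 0 l], whose cofactor is [d]. *)
have b_lin l : d * b 0 l = (x 0 i * b 0 j - x 0 j * b 0 i) * y 0 l
                           - (y 0 i * b 0 j - y 0 j * b 0 i) * x 0 l.
  (* The [(i, j, l)] coordinate of [x ∧ y ∧ b = x ∧ x ∧ a]. *)
  have det0 : x 0 i * (y 0 j * b 0 l - y 0 l * b 0 j)
            - x 0 j * (y 0 i * b 0 l - y 0 l * b 0 i)
            + x 0 l * (y 0 i * b 0 j - y 0 j * b 0 i) = 0.
    by rewrite -!xayb; ring.
  by apply/eqP; rewrite -subr_eq0 -[X in _ == X]det0 /d; apply/eqP; ring.
have -> : b = d^-1 *: ((x 0 i * b 0 j - x 0 j * b 0 i) *: y
                       - (y 0 i * b 0 j - y 0 j * b 0 i) *: x).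
  by apply/rowP=> l; apply: (mulfI d0); rewrite b_lin !mxE mulVKf.
rewrite linearZ linearB !linearZ /= wedgexx scaler0 add0r wedgeC opprK.
by rewrite !memvZ ?memv_line.
Qed.

Definition wedge_space x : {vspace 'rV[F]_#|lower_pairs n|} :=
  limg (linfun (wedge x)).

Lemma wedge_spaceP x v : reflect (exists y, v = wedge x y) (v \in wedge_space x).
Proof.
apply: (iffP memv_imgP) => [[y _ ->] | [y ->]]; exists y; rewrite ?lfunE //.
exact: memvf.
Qed.

Lemma dim_wedge_space x : x != 0 -> \dim (wedge_space x) = n.-1.
Proof.
move=> x0; have := limg_ker_dim (linfun (wedge x)) fullv.
have -> : (fullv :&: lker (linfun (wedge x)) = <[x]>)%VS.
  by apply/vspaceP=> y; rewrite capfv memv_ker lfunE wedge_eq0.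
rewrite dim_vline x0 dimvf dim_matrix mul1r => dimE.
by rewrite -[RHS](congr1 predn dimE).
Qed.

Lemma wedge_spaceZ c x : c != 0 -> wedge_space (c *: x) = wedge_space x.
Proof.
move=> c0; apply/vspaceP=> v; apply/wedge_spaceP/wedge_spaceP => -[y ->].
  by exists (c *: y); rewrite wedgeZl linearZ.
by exists (c^-1 *: y); rewrite wedgeZl linearZ scalerA divff // scale1r.
Qed.

Lemma cap_wedge_space x y :
  wedge x y != 0 -> (wedge_space x :&: wedge_space y = <[wedge x y]>)%VS.
Proof.
move=> xy0; apply/eqP; rewrite eqEsubv; apply/andP; split.
  apply/subvP=> v; rewrite memv_cap => /andP[/wedge_spaceP[a ->]].
  by move=> /wedge_spaceP[b xayb]; rewrite xayb (wedge_eq_line xy0 xayb).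
rewrite -memvE memv_cap; apply/andP; split; apply/wedge_spaceP.
  by exists y.
by exists (- x); rewrite linearN /= [wedge y x]wedgeC opprK.
Qed.

Lemma dim_cap_wedge_space x y :
    x != 0 -> y != 0 -> wedge_space x <> wedge_space y ->
  \dim (wedge_space x :&: wedge_space y) = 1%N.
Proof.
move=> x0 y0 xy; suff w0 : wedge x y != 0.
  by rewrite cap_wedge_space // dim_vline w0.
apply/negP; rewrite wedge_eq0 // => /vlineP[c yE].
by apply: xy; rewrite yE wedge_spaceZ //; apply: contraNneq y0 => c0;
  rewrite yE c0 scale0r.
Qed.

Lemma eq_wedge_space x y :
    (2 < n)%N -> x != 0 -> y != 0 ->
  (wedge_space x == wedge_space y) = (y \in <[x]>%VS).
Proof.
move=> n2 x0 y0; apply/eqP/vlineP => [xy | [c yE]]; last first.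
  by rewrite yE wedge_spaceZ //; apply: contraNneq y0 => c0;
    rewrite yE c0 scale0r.
apply/vlineP; rewrite -wedge_eq0 //; apply/negPn/negP=> w0.
(* Equal spaces coincide with their intersection, a line, although their dimension [n.-1] is at
   least 2. *)
have := dim_vline (wedge x y); rewrite -cap_wedge_space // -xy capvv w0.
by rewrite dim_wedge_space //; case: n n2 => [|[|[]]].
Qed.

End Wedge.

(** Scaling [x] is injective on the nonzero scalars. This gives the fibre size in the count of
    codewords. *)
Lemma card_nonzero_line (F : finFieldType) (n : nat) (x : 'rV[F]_n) :
  x != 0 -> #|[set y : 'rV[F]_n | (y != 0) && (y \in <[x]>%VS)]| = (#|F| - 1)%N.
Proof.
move=> x0; have injx : injective (fun c : F => c *: x).
  by move=> c d /eqP; rewrite -subr_eq0 -scalerBl scaler_eq0 (negPf x0) orbF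
    subr_eq0 => /eqP.
rewrite subn1 -(cardC1 (0 : F)) -(card_imset _ injx).
apply: eq_card => y; rewrite inE; apply/andP/imsetP => [[y0 /vlineP[c yE]] | ].
  by exists c => //; rewrite inE; apply: contraNneq y0 => c0; rewrite yE c0 scale0r.
case=> c; rewrite inE => c0 ->.
by rewrite scaler_eq0 (negPf c0) (negPf x0) memvZ ?memv_line.
Qed.

(** Ranging over all nonzero vectors avoids choosing representatives of projective points; the image
    merges proportional vectors. *)
Definition wedge_code (F : finFieldType) (n : nat) : code F #|lower_pairs n| :=
  [fset wedge_space x | x in [fset x : 'rV[F]_n | x != 0]]%fset.

Lemma wedge_codeP (F : finFieldType) (n : nat) X :
  reflect (exists2 x : 'rV[F]_n, x != 0 & X = wedge_space x)
          (X \in wedge_code F n).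
Proof.
by apply: (iffP (imfsetP _ _ _ _)) => -[x]; rewrite ?inE /= => x0 ->; exists x;
  rewrite ?inE.
Qed.

(** The nonzero vectors are counted twice: directly, and along the fibres of [wedge_space], which by
    [eq_wedge_space] are lines without the origin. *)
Lemma card_wedge_code (F : finFieldType) (n : nat) :
  (2 < n)%N -> #|` wedge_code F n|%fset = ((#|F| ^ n - 1) %/ (#|F| - 1))%N.
Proof.
move=> n2; have F1 : (0 < #|F| - 1)%N by rewrite subn_gt0 card_finNzRing_gt1.
suff <- : (#|` wedge_code F n|%fset * (#|F| - 1) = #|F| ^ n - 1)%N by rewrite mulnK.
have <- : (\sum_(x <- [fset x : 'rV[F]_n | x != 0%R]%fset) 1 = #|F| ^ n - 1)%N.
  rewrite big_fset /= big_enum_cond sum1_card -[n in (_ ^ n)%N]mul1n -card_mx subn1.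
  by rewrite -(cardC1 (0 : 'rV[F]_n)).
rewrite (partition_big_imfset _ (@wedge_space F n)) -/(wedge_code F n).
rewrite card_fset_sum1 big_distrl /= big_seq_cond [RHS]big_seq_cond.
apply: eq_bigr => _ /andP[/wedge_codeP[x x0 ->] _].
rewrite mul1n -(card_nonzero_line x0) big_mkcond big_fset /=.
rewrite big_enum_cond -big_mkcondr -sum1dep_card; apply: eq_bigl => y.
by rewrite inE /=; case: eqP => //= /eqP y0; rewrite eq_sym eq_wedge_space.
Qed.

Local Close Scope ring_scope.

Theorem theorem15 (n q : nat) (hn : 3 <= n) (hq : prime_power q)
    (F : finFieldType) (hF : #|F| = q) :
  exists C : code F 'C(n, 2),
    [/\ {subset C <= grassmannian F 'C(n, 2) n.-1},
        #|` C|%fset = (q ^ n - 1) %/ (q - 1),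
        t_intersecting 1 C
      & equidistant C].
Proof.
rewrite -card_lower_pairs -hF; exists (wedge_code F n).
have meet : t_intersecting 1 (wedge_code F n).
  move=> _ _ /wedge_codeP[x x0 ->] /wedge_codeP[y y0 ->].
  exact: dim_cap_wedge_space.
have dimC : {subset wedge_code F n <= grassmannian F #|lower_pairs n| n.-1}.
  by move=> _ /wedge_codeP[x x0 ->]; rewrite inE dim_wedge_space.
split=> //; first exact: card_wedge_code.
exists (n.-1 + n.-1 - 2 * 1)%N => X Y XC YC neqXY.
by rewrite /subspace_dist meet // (eqP (dimC X XC)) (eqP (dimC Y YC)).
Qed.
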